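(* Let $\Gamma$ be a finite, simple, connected graph of diameter $2$. Then $\Gamma$ is $2$-distance-balanced if and only if $\Gamma = \Gamma_1 + \Gamma_2 + \cdots + \Gamma_t$ for some $t \ge 1$, where each $\Gamma_i$ is a regular graph.
   Context: The join $\Gamma_1 + \Gamma_2$ of graphs with disjoint vertex sets is the disjoint union of $\Gamma_1$ and $\Gamma_2$ together with all edges joining a vertex of $\Gamma_1$ to a vertex of $\Gamma_2$; the join is commutative and associative, so $\Gamma_1 + \cdots + \Gamma_t$ is well defined (for $t=1$ it is just $\Gamma_1$). For vertices $u,v$, $W_{uv} = \{w \mid d(u,w) < d(v,w)\}$. A connected graph of diameter at least $2$ is $2$-distance-balanced if $|W_{uv}| = |W_{vu}|$ for all $u,v$ with $d(u,v)=2$. *)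

(* Defs.v *)
From mathcomp Require Import all_boot.

Set Implicit Arguments.
Unset Strict Implicit.
Unset Printing Implicit Defensive.

(* As usual, a graph has at least one vertex. *)
Record sgraph := SGraph {
  svertex :> finType;
  adj : rel svertex;
  adj_sym : symmetric adj;
  adj_irr : irreflexive adj;
  sgraph_nonempty : 0 < #|svertex|
}.

Definition gconnected (G : sgraph) : Prop := forall u v : G, connect (@adj G) u v.

Definition has_walk (G : sgraph) (u v : G) (n : nat) : bool :=
  [exists p : n.-tuple G, path (@adj G) u p && (last u p == v)].

(* The least n such that there is a walk of length n from u to v.  Two vertices
   in the same component are at distance less than #|G|, so the search is
   exhaustive; it returns #|G| when u and v lie in different components. *)
Definition gdist (G : sgraph) (u v : G) : nat :=
  find (has_walk u v) (iota 0 #|G|).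

Definition diameter (G : sgraph) : nat := \max_(u : G) \max_(v : G) gdist u v.

Definition Wset (G : sgraph) (u v : G) : {set G} :=
  [set w | gdist u w < gdist v w].

Definition two_distance_balanced (G : sgraph) : Prop :=
  [/\ gconnected G, 2 <= diameter G &
      forall u v : G, gdist u v = 2 -> #|Wset u v| = #|Wset v u|].

Definition degree (G : sgraph) (v : G) : nat := #|[set w | adj v w]|.

Definition regular (G : sgraph) : Prop :=
  exists k : nat, forall v : G, degree v = k.

Section Join.
Variables G H : sgraph.

Definition join_adj : rel (G + H) := fun x y =>
  match x, y with
  | inl a, inl b => adj a b
  | inr a, inr b => adj a b
  | _, _ => true
  end.

Lemma join_adj_sym : symmetric join_adj.
Proof. by case=> x [] y //=; apply: adj_sym. Qed.

Lemma join_adj_irr : irreflexive join_adj.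
Proof. by case=> x /=; apply: adj_irr. Qed.

Lemma join_nonempty : 0 < #|{: G + H}|.
Proof. by rewrite card_sum addn_gt0 sgraph_nonempty. Qed.

Definition join : sgraph := SGraph join_adj_sym join_adj_irr join_nonempty.
End Join.

(* G 0 + G 1 + ... + G n, a join of n.+1 graphs. *)
Fixpoint iterated_join (G : nat -> sgraph) (n : nat) : sgraph :=
  if n is m.+1 then join (iterated_join G m) (G m.+1) else G 0.

Definition isomorphic (G H : sgraph) : Prop :=
  exists2 f : G -> H, bijective f & forall x y : G, adj (f x) (f y) = adj x y.

(* Main.v *)
Require Import Defs.
From mathcomp Require Import all_boot.

(** In a graph of diameter 2, two vertices at distance 2 satisfy
    [W_uv = {u} ∪ (N(u) \ N(v))], so [|W_uv| = |W_vu|] says exactly that [u] and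
    [v] have the same degree: being 2-distance-balanced amounts to distinct
    nonadjacent vertices having equal degrees.  This property holds in regular
    graphs and is inherited by joins.  Conversely, it forces vertices of
    different degrees to be adjacent, so the graph is the join of its degree
    classes, and each of these induces a regular graph. *)

Set Implicit Arguments.
Unset Strict Implicit.
Unset Printing Implicit Defensive.

Definition nonadj_eq_degree (G : sgraph) : Prop :=
  forall u v : G, u != v -> ~~ adj u v -> degree u = degree v.

Lemma degreeE (G : sgraph) (v : G) : degree v = \sum_(w : G) (adj v w : nat).
Proof.
rewrite /degree -sum1dep_card big_mkcond /=.
by apply: eq_bigr => w _; case: (adj v w).
Qed.

(** * Distances *)

Lemma has_walk0 (G : sgraph) (u v : G) : has_walk u v 0 = (u == v).
Proof.
apply/existsP/idP => [[p]|uv]; first by rewrite tuple0.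
by exists [tuple].
Qed.

Lemma has_walk1 (G : sgraph) (u v : G) : has_walk u v 1 = adj u v.
Proof.
apply/existsP/idP => [[p]|uv]; last by exists [tuple v]; rewrite /= uv eqxx.
case/tupleP: p => x p; rewrite (tuple0 p) /= andbT.
by case/andP=> ux /eqP <-.
Qed.

Lemma gdistxx (G : sgraph) (u : G) : gdist u u = 0.
Proof.
rewrite /gdist; case: #|G| (sgraph_nonempty G) => // n _ /=.
by rewrite has_walk0 eqxx.
Qed.

Lemma gdist_neq (G : sgraph) (u v : G) :
  u != v -> (0 < gdist u v) * ((gdist u v == 1) = adj u v).
Proof.
(* Two distinct vertices ensure that the search range [iota 0 #|G|] starts with both 0 and 1. *)
move=> uv; have : 1 < #|G| by apply/card_gt1P; exists u, v.
rewrite /gdist; case: #|G| => [|[|n]] // _ /=.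
rewrite has_walk0 has_walk1 (negbTE uv).
by case: (adj u v).
Qed.

Lemma gdist_le_diameter (G : sgraph) (u v : G) : gdist u v <= diameter G.
Proof.
apply: leq_trans (leq_bigmax (F := fun u : G => \max_(v : G) gdist u v) u).
exact: (leq_bigmax (F := fun v : G => gdist u v)).
Qed.

(** The diameter bounds the distance by 2; for distinct vertices 0 is excluded and 1 means
    adjacency, so only 2 remains otherwise. *)
Lemma gdist_diameter2 (G : sgraph) (u v : G) : diameter G = 2 ->
  gdist u v = if u == v then 0 else if adj u v then 1 else 2.
Proof.
move=> diam; have := gdist_le_diameter u v; rewrite diam.
case: eqVneq => [<-|uv]; first by rewrite gdistxx.
have [d0 <-] := gdist_neq uv; move: d0.
by case: (gdist u v) => [|[|[|d]]].
Qed.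

Lemma gdist_eq2 (G : sgraph) (u v : G) : diameter G = 2 ->
  (gdist u v == 2) = (u != v) && ~~ adj u v.
Proof.
by move=> diam; rewrite gdist_diameter2 //; case: (u == v); case: (adj u v).
Qed.

(** Adding the common neighbours to [Wset u v] recovers all of N(u), together with [u] itself. The
    first summand is symmetric in [u] and [v], so it cancels when the two sides are compared. *)
Lemma card_Wset_diameter2 (G : sgraph) (u v : G) : diameter G = 2 ->
    u != v -> ~~ adj u v ->
  #|[set w | adj u w] :&: [set w | adj v w]| + #|Wset u v| = (degree u).+1.
Proof.
move=> diam uv nuv.
have -> : Wset u v = u |: ([set w | adj u w] :\: [set w | adj v w]).
  apply/setP=> w; rewrite !inE !gdist_diameter2 //.
  case: (eqVneq w u) => [->|wu] /=.
    by rewrite [v == u]eq_sym (negbTE uv) adj_sym (negbTE nuv).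
  case: (eqVneq v w) => [<-|vw]; first by rewrite (negbTE nuv) andbF.
  by case: (adj u w); case: (adj v w).
by rewrite cardsU1 !inE adj_irr andbF add1n addnS cardsID.
Qed.

Lemma two_distance_balancedE (G : sgraph) : gconnected G -> diameter G = 2 ->
  two_distance_balanced G <-> nonadj_eq_degree G.
Proof.
move=> conn diam; split=> [[_ _ bal] u v uv nuv|P].
  have d2 : gdist u v = 2 by apply/eqP; rewrite gdist_eq2 // uv.
  apply: succn_inj; rewrite -(card_Wset_diameter2 diam uv nuv) bal // setIC.
  by rewrite card_Wset_diameter2 // ?[v == u]eq_sym // adj_sym.
split=> // [|u v /eqP]; first by rewrite diam.
rewrite gdist_eq2 // => /andP[uv nuv].
have vu : v != u by rewrite eq_sym.
have nvu : ~~ adj v u by rewrite adj_sym.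
have := card_Wset_diameter2 diam uv nuv.
by rewrite (P u v uv nuv) -(card_Wset_diameter2 diam vu nvu) setIC => /addnI.
Qed.

(** * Isomorphisms *)

Lemma isomorphic_refl (G : sgraph) : isomorphic G G.
Proof. by exists id => //; exists id. Qed.

Lemma isomorphic_sym (G H : sgraph) : isomorphic G H -> isomorphic H G.
Proof.
case=> f [g fK gK] fadj; exists g; first by exists f.
by move=> x y; rewrite -fadj !gK.
Qed.

Lemma isomorphic_trans (G H K : sgraph) :
  isomorphic G H -> isomorphic H K -> isomorphic G K.
Proof.
case=> f bf fadj [g bg gadj]; exists (g \o f); first exact: bij_comp.
by move=> x y /=; rewrite gadj fadj.
Qed.

Lemma isomorphic_joinl (G H K : sgraph) :
  isomorphic G H -> isomorphic (join G K) (join H K).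
Proof.
case=> f [g fK gK] fadj.
exists (fun x : join G K => match x with inl a => inl (f a) | inr b => inr b end).
  exists (fun x : join H K => match x with inl a => inl (g a) | inr b => inr b end).
    by case=> x //=; rewrite fK.
  by case=> x //=; rewrite gK.
by case=> x [y|y] //=; rewrite fadj.
Qed.

Lemma degree_iso (G H : sgraph) (f : G -> H) : bijective f ->
    (forall x y, adj (f x) (f y) = adj x y) ->
  forall x, degree (f x) = degree x.
Proof.
move=> bf fadj x; rewrite !degreeE (reindex f) /=; last exact: onW_bij.
by apply: eq_bigr => y _; rewrite fadj.
Qed.

Lemma nonadj_eq_degree_iso (G H : sgraph) :
  isomorphic G H -> nonadj_eq_degree H -> nonadj_eq_degree G.
Proof.
case=> f bf fadj P u v uv nuv.
rewrite -!(degree_iso bf fadj); apply: P; last by rewrite fadj.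
by rewrite (inj_eq (bij_inj bf)).
Qed.

(** * Joins *)

Lemma degree_joinl (G H : sgraph) (a : G) :
  degree (inl a : join G H) = degree a + #|H|.
Proof. by rewrite !degreeE big_sumType /= sum1_card. Qed.

Lemma degree_joinr (G H : sgraph) (b : H) :
  degree (inr b : join G H) = #|G| + degree b.
Proof. by rewrite !degreeE big_sumType /= sum1_card. Qed.

(** Nonadjacent vertices of a join lie on the same side, and joining shifts all degrees on one side
    by the same constant. *)
Lemma nonadj_eq_degree_join (G H : sgraph) :
  nonadj_eq_degree (join G H) <-> nonadj_eq_degree G /\ nonadj_eq_degree H.
Proof.
split=> [P|[PG PH]].
  split=> u v uv nuv.
    by apply: (@addIn #|H|); rewrite -!degree_joinl; apply: P.
  by apply: (@addnI #|G|); rewrite -!degree_joinr; apply: P.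
case=> u [v|v] //= uv nuv; rewrite ?degree_joinl ?degree_joinr.
  by rewrite (PG u v).
by rewrite (PH u v).
Qed.

Lemma regular_nonadj_eq_degree (G : sgraph) : regular G -> nonadj_eq_degree G.
Proof. by case=> k dk u v _ _; rewrite !dk. Qed.

Lemma nonadj_eq_degree_iterated_join (G : nat -> sgraph) (n : nat) :
  (forall i, i <= n -> regular (G i)) -> nonadj_eq_degree (iterated_join G n).
Proof.
elim: n => [|n IH] reg /=; first by apply/regular_nonadj_eq_degree/reg.
apply/nonadj_eq_degree_join; split; last by apply/regular_nonadj_eq_degree/reg.
by apply: IH => i /leqW; apply: reg.
Qed.

(** Allows a sequence of factors to be redefined beyond index [n], so that a new last factor can be
    appended. *)
Lemma eq_iterated_join (G H : nat -> sgraph) (n : nat) :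
  (forall i, i <= n -> G i = H i) -> iterated_join G n = iterated_join H n.
Proof.
elim: n => [|n IH] eqGH /=; first exact: eqGH.
by rewrite IH ?eqGH // => i /leqW; apply: eqGH.
Qed.

(** * Decomposition into degree classes *)

Section Induced.
Variables (G : sgraph) (A : {set G}) (A_gt0 : 0 < #|A|).

Let ind_adj : rel {x : G | x \in A} := fun x y => adj (val x) (val y).

Fact induced_sym : symmetric ind_adj.
Proof. by move=> x y; apply: adj_sym. Qed.

Fact induced_irr : irreflexive ind_adj.
Proof. by move=> x; apply: adj_irr. Qed.

Fact induced_nonempty : 0 < #|{: {x : G | x \in A}}|.
Proof. by rewrite card_sig. Qed.

Definition induced : sgraph := SGraph induced_sym induced_irr induced_nonempty.
End Induced.

Section JoinInduced.
Variables (G : sgraph) (A : {set G}) (CA_gt0 : 0 < #|~: A|) (A_gt0 : 0 < #|A|).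

(** The complement of [A] stands on the left because [iterated_join] grows on the right: it is
    decomposed further, while [A] becomes the last factor. *)
Definition join_val (x : join (induced CA_gt0) (induced A_gt0)) : G :=
  match x with inl a => val a | inr b => val b end.

Lemma join_val_bij : bijective join_val.
Proof.
apply: inj_card_bij; last by rewrite card_sum !card_sig addnC cardsC.
case=> [[x xA]|[x xA]] [[y yA]|[y yA]] /= exy.
- by congr inl; apply: val_inj.
- by exfalso; move: xA; rewrite inE exy yA.
- by exfalso; move: yA; rewrite inE -exy xA.
- by congr inr; apply: val_inj.
Qed.

Lemma adj_join_val : (forall x y, x \notin A -> y \in A -> adj x y) ->
  forall x y, adj (join_val x) (join_val y) = adj x y.
Proof.
move=> cross [[x xA]|[x xA]] [[y yA]|[y yA]] //=.
  by apply: cross => //; rewrite -in_setC.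
by rewrite adj_sym cross // -in_setC.
Qed.
End JoinInduced.

(* Split off one degree class at a time. *)
Lemma nonadj_eq_degree_decomp (G : sgraph) : nonadj_eq_degree G ->
  exists (n : nat) (H : nat -> sgraph),
    (forall i, i <= n -> regular (H i)) /\ isomorphic G (iterated_join H n).
Proof.
have [m] := ubnP #|G|; elim: m G => // m IH G ltGm P.
have [v _] : exists v : G, v \in G by apply/card_gt0P/sgraph_nonempty.
pose A := [set x : G | degree x == degree v].
have A_gt0 : 0 < #|A| by apply/card_gt0P; exists v; rewrite inE.
(* If the degree class of [v] is everything, [G] is regular and is its own single factor. *)
have [CA0|CA_gt0] := posnP #|~: A|.
  exists 0, (fun=> G); split=> [_ _|]; last exact: isomorphic_refl.
  exists (degree v) => x; apply/eqP.
  by have := in_set0 x; rewrite -(cards0_eq CA0) !inE => /negbFE.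
have cross x y : x \notin A -> y \in A -> adj x y.
  rewrite !inE => xA /eqP yA; apply: contraR xA => nxy.
  by have [->|xy] := eqVneq x y; rewrite -yA // (P x y).
have bij_val := join_val_bij CA_gt0 A_gt0.
have adj_val := adj_join_val (CA_gt0 := CA_gt0) (A_gt0 := A_gt0) cross.
have isoG : isomorphic (join (induced CA_gt0) (induced A_gt0)) G.
  by exists (@join_val _ _ CA_gt0 A_gt0).
have regA : regular (induced A_gt0).
  (* Each vertex of [A] has degree [degree v] in [G] and is adjacent to every vertex outside [A];
     removing those neighbours leaves a constant. *)
  exists (degree v - #|induced CA_gt0|) => b.
  have /eqP <- : degree (val b) == degree v by have := valP b; rewrite inE.
  by rewrite (degree_iso bij_val adj_val (inr b)) degree_joinr addKn.
have [|PC _] := (nonadj_eq_degree_join (induced CA_gt0) (induced A_gt0)).1.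
  exact: nonadj_eq_degree_iso P.
have [|n [H [regH isoH]]] := IH (induced CA_gt0) _ PC.
  rewrite -ltnS; apply: leq_trans ltGm.
  by rewrite card_sig ltnS -(cardsC A) -[ltnLHS]add0n ltn_add2r.
(* The factors of the complement keep the indices 0 to [n], and the class [A] takes index [n.+1]. *)
exists n.+1, (fun i => if i <= n then H i else induced A_gt0); split=> [i _|].
  by case: ifP => // /regH.
apply: isomorphic_trans (isomorphic_sym isoG) _ => /=; rewrite ltnn.
rewrite (@eq_iterated_join _ H) => [|i ->] //.
exact: isomorphic_joinl.
Qed.

Theorem theorem3p1 (Gamma : sgraph) (hconn : gconnected Gamma)
    (hdiam : diameter Gamma = 2) :
  two_distance_balanced Gamma <->
  exists (t : nat) (G : nat -> sgraph),
    [/\ 1 <= t,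
        forall i : nat, i < t -> regular (G i) &
        isomorphic Gamma (iterated_join G t.-1)].
Proof.
split=> [/(two_distance_balancedE hconn hdiam)/nonadj_eq_degree_decomp|].
  (* Last index [n] means [n.+1] factors, since indices start at 0. *)
  by case=> n [G [reg iso]]; exists n.+1, G.
case=> [[|n]] [G [//= _ reg iso]]; apply/two_distance_balancedE => //.
exact/(nonadj_eq_degree_iso iso)/nonadj_eq_degree_iterated_join.
Qed.
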